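(* Let $P$ be an $n\times n$ sign pattern, let $A\in\mathcal{Q}(P)\subseteq\operatorname{Mat}_n(\mathbb{R})$ and let $J_A$ be its associated Jacobian matrix. Then $J_A$ has full row rank if and only if the minimal polynomial of $A$ has degree $n$ and $A$ has the nSSP.
   Context: $\operatorname{Mat}_n(\mathbb{R})$ is the space of real $n\times n$ matrices. A sign pattern $P$ is a matrix with entries in $\{+,-,0\}$, and $\mathcal{Q}(P)$ is the set of all real matrices whose entries have the signs of the corresponding entries of $P$. A matrix $A\in\mathcal{Q}(P)$ has the non-symmetric strong spectral property (nSSP) if $T_1+T_2=\operatorname{Mat}_n(\mathbb{R})$, where $T_1=\operatorname{span}(\mathcal{Q}(P))$ and $T_2=\{-LA+AL: L\in\operatorname{Mat}_n(\mathbb{R})\}$. For a square matrix $M$, $s_k(M)$ is the sum of all $k\times k$ principal minors of $M$. Let $e_1,\ldots,e_r$ be the positions of the nonzero entries of $A$ (equivalently of $P$), and let $E_{e_j}$ be the $n\times n$ matrix with entry $1$ at position $e_j$ and $0$ elsewhere. The Jacobian matrix $J_A$ is the $n\times r$ matrix with $(i,j)$-entry $\frac{d}{dt}s_i(A+tE_{e_j})\big|_{t=0}$, for $i=1,\ldots,n$, $j=1,\ldots,r$. *)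

(* Defs.v *)
From HB Require Import structures.
From mathcomp Require Import all_boot all_order all_algebra.
From mathcomp Require Import all_classical all_reals all_analysis.
Set Implicit Arguments.
Unset Strict Implicit.
Unset Printing Implicit Defensive.
Import Order.TTheory GRing.Theory Num.Theory.
Import numFieldNormedType.Exports.
Local Open Scope classical_set_scope.
Local Open Scope ring_scope.

Inductive sign : Type := Plus | Minus | Zero.

Definition has_sign (R : realType) (s : sign) (x : R) : Prop :=
  match s with
  | Plus => 0 < x
  | Minus => x < 0
  | Zero => x = 0
  end.

Definition sign_pattern (n : nat) : Type := 'M[sign]_n.

Definition qual_class (R : realType) (n : nat) (P : sign_pattern n) :
    set 'M[R]_n :=
  [set A | forall i j, has_sign (P i j) (A i j)].
Arguments qual_class R {n} P.

(* MathComp's <<X>>%VS only spans finite sequences; qual_class is an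
   arbitrary, possibly infinite, set. *)
Definition lin_span (R : realType) (V : lmodType R) (S : set V) : set V :=
  [set v | exists (k : nat) (c : 'I_k -> R) (u : 'I_k -> V),
     (forall i, S (u i)) /\ v = \sum_(i < k) c i *: u i].

Definition T1 (R : realType) (n : nat) (P : sign_pattern n) : set 'M[R]_n :=
  lin_span (qual_class R P).
Arguments T1 R {n} P.

Definition T2 (R : realType) (n : nat) (A : 'M[R]_n) : set 'M[R]_n :=
  [set - (L *m A) + A *m L | L in [set: 'M[R]_n]].

(* Meaningful when A belongs to qual_class R P. *)
Definition nSSP (R : realType) (n : nat) (P : sign_pattern n) (A : 'M[R]_n) :
    Prop :=
  [set X + Y | X in T1 R P & Y in T2 A] = [set: 'M[R]_n].

Definition principal_minor (R : realType) (n : nat) (M : 'M[R]_n)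
    (S : {set 'I_n}) : R :=
  \det (\matrix_(a < #|S|, b < #|S|) M (enum_val a) (enum_val b)).

Definition sum_principal_minors (R : realType) (n : nat) (k : nat)
    (M : 'M[R]_n) : R :=
  \sum_(S : {set 'I_n} | #|S| == k) principal_minor M S.

(* e lists the positions of the nonzero entries of A, each exactly once, in an
   arbitrary order. *)
Definition enumerates_nonzero (R : realType) (n r : nat) (A : 'M[R]_n)
    (e : r.-tuple ('I_n * 'I_n)) : Prop :=
  uniq e /\ forall p : 'I_n * 'I_n, (p \in e) = (A p.1 p.2 != 0).

(* Row i : 'I_n is 0-based, hence holds the derivatives of s_(i+1). *)
Definition pattern_jacobian (R : realType) (n r : nat) (A : 'M[R]_n)
    (e : r.-tuple ('I_n * 'I_n)) : 'M[R]_(n, r) :=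
  \matrix_(i < n, j < r)
    (derive1 (fun t : R => sum_principal_minors i.+1
      (A + t *: delta_mx (tnth e j).1 (tnth e j).2)) 0 : R).

(* Main.v *)
Require Import Defs.
From HB Require Import structures.
From mathcomp Require Import all_boot all_order all_algebra.
From mathcomp Require Import perm.
From mathcomp Require Import all_classical all_reals all_analysis.
From mathcomp Require Import ring lra zify.
Set Implicit Arguments.
Unset Strict Implicit.
Unset Printing Implicit Defensive.
Import Order.TTheory GRing.Theory Num.Theory.
Import numFieldNormedType.Exports.
Local Open Scope ring_scope.

(** Write N = n.+1, q = char_poly A and R(X) = adj (X - A).  Up to the sign
    (-1)^k, the number s_k(A) is the coefficient of X^(N-k) in q
    ([coef_char_poly_minors]), and det is affine in each single entry, with
    slope a cofactor ([det_add_delta]).  Hence the row of the Jacobian that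
    belongs to s_k lists, up to sign, entries of the coefficient of X^(N-k)
    in R.  Comparing coefficients in R(X) (X - A) = q shows that this
    coefficient is a monic polynomial of degree k-1 evaluated at A
    ([coef_adj_char_poly_mx]).  These N polynomials form a basis of the
    polynomials of degree < N, so a linear relation between the rows of the
    Jacobian is a polynomial p of degree < N such that p(A)^T vanishes at every
    nonzero position of A; full row rank says that p = 0 is the only one
    ([row_free_jacobian]).

    On the other side, for the pairing (M, X) |-> tr (M X), a matrix M is
    orthogonal to T2 if and only if it commutes with A, and it is orthogonal to
    T1 if and only if M^T vanishes at every nonzero position of A.  So the nSSP
    says that M = 0 is the only matrix with both properties ([nSSP_dual]).

    Matrices p(A) commute with A, and if the minimal polynomial has degree N
    they are all the matrices that commute with A ([comm_mx_horner_mx]), while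
    p(A) = 0 with deg p < N forces p = 0.  The two conditions then coincide.
    Finally, full row rank implies that the minimal polynomial has degree N:
    one of smaller degree would itself be a nonzero p as above.

    The commutant is computed without cyclic vectors.  When the minimal
    polynomial has degree N, the entries of R generate the unit ideal, say
    tr (C R) = 1 ([adj_bezout]).  Modulo q the matrix R behaves like a matrix
    of rank one: R S R = tr (S R) R ([adj_mul_adj]).  So if M commutes with A,
    then M R = M (R C R) = R (M C) R = tr (M C R) R modulo q; multiplying by
    X - A and cancelling q shows that M - tr (M C R) is a multiple of X - A,
    that is, M is the value at A of the polynomial tr (M C R). *)

(** * Principal minors and the characteristic polynomial *)

(** Reindexing rows and columns by the same bijection conjugates by a
    permutation matrix.  The two sizes are kept apart since a bijection obtained
    from a partition of the indices has #|S| + #|~: S| as its source. *)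
Lemma det_mxsub_inj (R : comNzRingType) p n (f : 'I_p -> 'I_n) (B : 'M[R]_n) :
  p = n -> injective f -> \det (mxsub f f B) = \det B.
Proof.
move=> epn; case: n / epn f B => f B f_inj.
pose s := perm f_inj.
have -> : mxsub f f B = row_perm s (col_perm s B).
  by apply/matrixP=> i j; rewrite !mxE !permE.
rewrite row_permE col_permE !det_mulmx !det_perm odd_permV mulrC -mulrA.
by rewrite -signr_addb addbb mulr1.
Qed.

(** Multilinearity in all the rows at once: distribute the product over rows in
    the Leibniz formula. *)
Lemma detD_rows (R : comNzRingType) n (X Y : 'M[R]_n) :
  \det (X + Y) =
  \sum_(S : {set 'I_n}) \det (\matrix_(i, j) if i \in S then X i j else Y i j).
Proof.
rewrite /determinant exchange_big; apply: eq_bigr => s _ /=.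
under eq_bigr do rewrite mxE.
rewrite bigA_distr big_distrr /=; apply: eq_bigr => S _; congr (_ * _).
by apply: eq_bigr => i _; rewrite mxE.
Qed.

(** Listing the indices in S first makes the matrix block upper triangular, with
    the submatrix of M on S and a scalar matrix as diagonal blocks. *)
Lemma det_rows_scalar (R : comNzRingType) n (S : {set 'I_n}) (M : 'M[R]_n) a :
  \det (\matrix_(i, j) if i \in S then M i j else a%:M i j) =
  a ^+ (n - #|S|) *
  \det (\matrix_(i < #|S|, j < #|S|) M (enum_val i) (enum_val j)).
Proof.
set B := \matrix_(i, j) _.
have eT : (#|S| + #|~: S| = n)%N by rewrite cardsC card_ord.
pose f (k : 'I_(#|S| + #|~: S|)) : 'I_n :=
  match fintype.split k with inl i => enum_val i | inr j => enum_val j end.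
have fl i : f (lshift _ i) = enum_val i by rewrite /f (unsplitK (inl _ i)).
have fr i : f (rshift _ i) = enum_val i by rewrite /f (unsplitK (inr _ i)).
have in_l (i : 'I_#|S|) : enum_val i \in S by exact: enum_valP.
have in_r (i : 'I_#|~: S|) : (enum_val i \in S) = false.
  by apply/negbTE; rewrite -finset.in_setC; exact: enum_valP.
have f_inj : injective f.
  move=> x y; rewrite -(splitK x) -(splitK y).
  case: (fintype.split x) => i; case: (fintype.split y) => j; rewrite /unsplit ?fl ?fr.
  - by move/enum_val_inj->.
  - by move=> e; have := in_l i; rewrite e in_r.
  - by move=> e; have := in_l j; rewrite -e in_r.
  - by move/enum_val_inj->.
rewrite -(det_mxsub_inj B eT f_inj) -[mxsub f f B]submxK.
have -> : dlsubmx (mxsub f f B) = 0.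
  apply/matrixP=> i j; rewrite !mxE fl fr in_r.
  by case: eqP (in_l j) => // <-; rewrite in_r.
have -> : drsubmx (mxsub f f B) = a%:M.
  by apply/matrixP=> i j; rewrite !mxE !fr in_r (inj_eq enum_val_inj).
rewrite det_ublock det_scalar [LHS]mulrC.
have -> : (n - #|S|)%N = #|~: S| by rewrite -[X in (X - _)%N]eT addKn.
congr (_ * \det _).
by apply/matrixP=> i j; rewrite !mxE !fl in_l.
Qed.

Lemma coef_char_poly_minors (R : comNzRingType) n (M : 'M[R]_n) k : (k <= n)%N ->
  (char_poly M)`_(n - k) = (-1) ^+ k *
  \sum_(S : {set 'I_n} | #|S| == k)
    \det (\matrix_(i < #|S|, j < #|S|) M (enum_val i) (enum_val j)).
Proof.
move=> lekn; rewrite /char_poly /char_poly_mx addrC detD_rows coef_sum.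
rewrite mulr_sumr [RHS]big_mkcond /=; apply: eq_bigr => S _.
rewrite det_rows_scalar mulrC coefMXn.
have leSn : (#|S| <= n)%N by rewrite -[leqRHS](card_ord n) max_card.
set D := \det _.
have -> : D = ((-1) ^+ #|S| *
    \det (\matrix_(i < #|S|, j < #|S|) M (enum_val i) (enum_val j)))%:P.
  rewrite -detZ -det_map_mx; congr (\det _).
  by apply/matrixP=> i j; rewrite !mxE mulN1r rmorphN.
move: (\det _) => d; rewrite coefC subn_eq0 !leq_sub2lE // ltnNge leq_sub2lE //.
by case: (ltngtP #|S| k) => [h|h|->].
Qed.

(** * The adjugate of the characteristic matrix *)

(** The cofactors along row i do not see the perturbed row, so the Laplace
    expansion along that row is affine in c. *)
Lemma det_add_delta (R : comNzRingType) n (Y : 'M[R]_n) i j c :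
  \det (Y + c *: delta_mx i j) = \det Y + c * \adj Y j i.
Proof.
have cof k : cofactor (Y + c *: delta_mx i j) i k = cofactor Y i k.
  congr (_ * \det _); apply/matrixP=> a b; rewrite !mxE.
  by rewrite eq_sym (negbTE (neq_lift _ _)) mulr0 addr0.
rewrite !(expand_det_row _ i); under eq_bigr do rewrite cof !mxE eqxx mulrDl.
rewrite big_split /=; congr (_ + _).
rewrite (bigD1 j) //= eqxx mulr1 big1 ?addr0 ?mxE // => k /negbTE->.
by rewrite mulr0 mul0r.
Qed.

Lemma char_poly_add_delta (R : comNzRingType) n (M : 'M[R]_n) i j t :
  char_poly (M + t *: delta_mx i j) =
  char_poly M - t *: \adj (char_poly_mx M) j i.
Proof.
rewrite /char_poly -mul_polyC -mulNr -polyCN -det_add_delta; congr (\det _).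
rewrite /char_poly_mx map_mxD opprD addrA; congr (_ + _).
apply/matrixP=> a b; by rewrite !mxE /= polyCM polyCN polyC_natr mulNr.
Qed.

(** Comparing coefficients in R(X) (X - A) = q, where R(X) is the adjugate,
    gives R_k = R_(k+1) A + q_(k+1): this is Horner's scheme for the quotient
    of q by X^(k+1), evaluated at A. *)
Lemma coef_adj_char_poly_mx (R : comNzRingType) n (A : 'M[R]_n.+1) k i j :
  (\adj (char_poly_mx A) i j)`_k =
  horner_mx A (drop_poly k.+1 (char_poly A)) i j.
Proof.
have [phi [_ phiZ phiC phiE]] := mx_poly_ring_isom R n.
set q := char_poly A; set Q := phi (\adj (char_poly_mx A)).
have eQ : Q * ('X - A%:P) = map_poly scalar_mx q.
  by rewrite -phiZ -mul_adj_mx rmorphM /= rmorphB phiC phiZ map_polyX.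
have recQ l : Q`_l = Q`_l.+1 * A + (q`_l.+1)%:M.
  rewrite -coef_map -eQ mulrBr coefB coefMX coefMC /=.
  by rewrite addrC subrK.
have recq l : drop_poly l q = drop_poly l.+1 q * 'X + (q`_l)%:P.
  apply/polyP => -[|a]; rewrite coefD coefMX coefC !coef_drop_poly ?add0r //=.
  by rewrite addr0 addSnnS.
rewrite -phiE -/Q; suff -> : Q`_k = horner_mx A (drop_poly k.+1 q) by [].
(* The recursion runs downwards from the degrees above which Q and q vanish. *)
have [m] : exists m, (maxn (size Q) (size q) <= k + m)%N.
  by exists (maxn (size Q) (size q)); rewrite leq_addl.
elim: m => [|m IH] in k *.
  rewrite addn0 geq_max => /andP[leQ leq].
  rewrite nth_default // drop_poly_eq0 ?rmorph0 //; exact: leqW.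
rewrite -addSnnS => /IH e; rewrite recQ e [in RHS]recq rmorphD rmorphM /=.
by rewrite horner_mx_X horner_mx_C.
Qed.

Lemma mxtrace_delta_mul (R : pzSemiRingType) m n i j (M : 'M[R]_(n, m)) :
  \tr (delta_mx i j *m M) = M j i.
Proof.
rewrite /mxtrace (bigD1 i) //= big1 => [|k /negbTE nk].
  rewrite addr0 mxE (bigD1 j) //= big1 ?addr0 ?mxE ?eqxx ?mul1r // => k.
  by rewrite mxE andbC => /negbTE->; rewrite mul0r.
by rewrite mxE big1 // => l _; rewrite mxE nk mul0r.
Qed.

(** * Matrices commuting with a nonderogatory matrix *)

Lemma scalemx_inj (R : idomainType) m n (a : R) :
  a != 0 -> injective (fun M : 'M[R]_(m, n) => a *: M).
Proof.
move=> a0 M N /matrixP e; apply/matrixP=> i j.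
by have := e i j; rewrite !mxE => /(mulfI a0).
Qed.

(** Modulo det Y, the adjugate behaves like a matrix of rank one.  Both sides are
    linear in S, so S can be taken to be an elementary matrix; then take the
    coefficient of t in (Y + t S) adj (Y + t S) = det (Y + t S) and multiply it
    by adj Y on the left. *)
Lemma adj_mul_adj (R : comNzRingType) n (Y S : 'M[R]_n) :
  exists Z, \adj Y *m S *m \adj Y = \tr (S *m \adj Y) *: \adj Y + \det Y *: Z.
Proof.
rewrite [S]matrix_sum_delta.
have delta i j : exists Z, \adj Y *m delta_mx i j *m \adj Y =
    \tr (delta_mx i j *m \adj Y) *: \adj Y + \det Y *: Z.
  (* The polynomial variable of this ring plays the role of t. *)
  pose Q := \adj (map_mx polyC Y + 'X *: delta_mx i j).
  have Q0 : map_mx (coefp 0) Q = \adj Y.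
    rewrite map_mx_adj; congr (\adj _); apply/matrixP=> a b.
    by rewrite !mxE /= coefD coefC coefXM addr0.
  pose Z := map_mx (coefp 1) Q.
  have eZ : Y *m Z + delta_mx i j *m \adj Y = (\adj Y j i)%:M.
    have := mul_mx_adj (map_mx polyC Y + 'X *: delta_mx i j).
    rewrite -/Q det_add_delta det_map_mx -map_mx_adj mulmxDl -scalemxAl.
    move=> /(congr1 (map_mx (coefp 1))) /matrixP e; apply/matrixP=> a b.
    have {e} := e a b; rewrite !mxE /= !coefD coefXM /= => e.
    rewrite -Q0; transitivity (((\det Y)%:P + 'X * (cofactor Y i j)%:P) *+ (a == b))`_1.
      rewrite -e; congr (_ + _); rewrite !coef_sum; apply: eq_bigr => c _.
        by rewrite !mxE coefCM.
      by rewrite !mxE -polyC_natr coefCM.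
    by rewrite coefMn coefD coefC coefXM coefC add0r.
  exists (- Z).
  rewrite mxtrace_delta_mul.
  apply/eqP; rewrite scalerN eq_sym subr_eq -mulmxA; apply/eqP.
  rewrite -mul_mx_scalar -eZ mulmxDr (mulmxA _ Y) mul_adj_mx mul_scalar_mx.
  by rewrite addrC.
have add (S1 S2 : 'M[R]_n) :
  (exists Z, \adj Y *m S1 *m \adj Y =
     \tr (S1 *m \adj Y) *: \adj Y + \det Y *: Z) ->
  (exists Z, \adj Y *m S2 *m \adj Y =
     \tr (S2 *m \adj Y) *: \adj Y + \det Y *: Z) ->
  exists Z, \adj Y *m (S1 + S2) *m \adj Y =
     \tr ((S1 + S2) *m \adj Y) *: \adj Y + \det Y *: Z.
  move=> [Z1 e1] [Z2 e2]; exists (Z1 + Z2).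
  by rewrite mulmxDr !mulmxDl e1 e2 mxtraceD scalerDl scalerDr addrACA.
have zero : exists Z, \adj Y *m (0 : 'M[R]_n) *m \adj Y =
     \tr ((0 : 'M[R]_n) *m \adj Y) *: \adj Y + \det Y *: Z.
  by exists 0; rewrite mulmx0 !mul0mx mxtrace0 scale0r scaler0 addr0.
elim/big_ind: _ => // i _; elim/big_ind: _ => // j _.
have [Z e] := delta i j; exists (S i j *: Z).
by rewrite -scalemxAr -!scalemxAl e mxtraceZ scalerDr !scalerA [S i j * \det Y]mulrC.
Qed.

(** An element of minimal degree among the nonzero ones divides all the others,
    by Euclidean division. *)
Lemma poly_ideal_generator (F : fieldType) (I : {poly F} -> Prop) :
  I 0 -> (forall a f g, I f -> I g -> I (a * f + g)) ->
  exists2 g, I g & forall f, I f -> g %| f.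
Proof.
move=> I0 Ilin; case: (pselect (exists2 f, I f & f != 0)) => [[f If f0]|allz].
  have [m] : exists m, (size f <= m)%N by exists (size f).
  elim: m f If f0 => [|m IH] f If f0 lefm.
    by rewrite -size_poly_leq0 lefm in f0.
  case: (pselect (exists2 h, I h & ~~ (f %| h))) => [[h Ih]|alldvd].
    rewrite /dvdp => r0; apply: IH r0 _; last first.
      by rewrite -ltnS; apply: leq_trans lefm; rewrite ltn_modp.
    have -> : h %% f = - (h %/ f) * f + h by rewrite {3}(divp_eq h f) mulNr addKr.
    exact: Ilin.
  exists f => // h Ih; apply/negPn/negP => nfh; apply: alldvd; by exists h.
exists 0 => // f If; suff -> : f = 0 by rewrite dvdp0.
by apply/eqP/negPn/negP => f0; apply: allz; exists f.
Qed.

(** Matrices over F[X] are polynomials with matrix coefficients, for which the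
    right factor theorem says that right multiples of X - A have value 0 at A.
    The case M = 0 with W = - adj (X - A) is the Cayley-Hamilton theorem. *)
Lemma horner_mx_eq_of_factor (R : comNzRingType) n (A M : 'M[R]_n.+1) p W :
  map_mx polyC M - p%:M = W *m char_poly_mx A -> M = horner_mx A p.
Proof.
have [phi [_ phiZ phiC _]] := mx_poly_ring_isom R n => /(congr1 phi).
rewrite rmorphM !rmorphB /= !phiC !phiZ map_polyX => e.
suff : root (M%:P - map_poly scalar_mx p) A.
  by rewrite /root hornerD hornerN hornerC subr_eq0 => /eqP.
by apply/factor_theorem; exists (phi W).
Qed.

(** If g is a common divisor of the entries of R = adj (X - A), then
    R (X - A) = q gives (R / g) (X - A) = q / g, so q / g annihilates A.  Since
    the minimal polynomial has the degree of q, the generator g of the ideal of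
    all tr (C R) is constant. *)
Lemma adj_bezout (F : fieldType) n (A : 'M[F]_n.+1) :
  size (mxminpoly A) = n.+2 ->
  exists C, \tr (C *m \adj (char_poly_mx A)) = 1.
Proof.
move=> sz; set R := \adj _; set q := char_poly A.
have q0 : q != 0 by rewrite monic_neq0 ?char_poly_monic.
have [||g [C eC] dvd_g] := @poly_ideal_generator _ (fun f => exists C, \tr (C *m R) = f).
- by exists 0; rewrite mul0mx mxtrace0.
- move=> a _ _ [C1 <-] [C2 <-]; exists (a *: C1 + C2).
  by rewrite mulmxDl mxtraceD -scalemxAl mxtraceZ.
have dvd_R i j : g %| R i j.
  by apply: dvd_g; exists (delta_mx j i); rewrite mxtrace_delta_mul.
pose D := \matrix_(i, j) (R i j %/ g).
have eR : R = g *: D.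
  by apply/matrixP=> i j; rewrite [RHS]mxE [D i j]mxE mulrC divpK.
pose W := D *m char_poly_mx A; pose q' := W 0 0.
have eW : g *: W = q%:M by rewrite /q /W scalemxAl -eR mul_adj_mx.
have eq : q = g * q' by move/matrixP/(_ 0 0): eW; rewrite [LHS]mxE [RHS]mxE eqxx mulr1n => <-.
have [g0 q'0] : g != 0 /\ q' != 0.
  by apply/andP; rewrite -negb_or -mulf_eq0 -eq.
(* q' is defined as an entry of W; in fact W is the scalar matrix q / g. *)
have {}eW : W = q'%:M.
  by apply: (scalemx_inj g0); rewrite /= eW eq scale_scalar_mx.
have Aq' : horner_mx A q' = 0.
  apply/esym/(@horner_mx_eq_of_factor _ _ _ _ _ (- D)).
  by rewrite map_mx0 sub0r mulNmx -/W eW.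
have := dvdp_leq q'0 (mxminpoly_min Aq').
have : size q = n.+2 by rewrite size_char_poly.
rewrite eq size_mul // sz => <-.
have : (0 < size g)%N by rewrite size_poly_gt0.
case eg : (size g) => [//|[|s]] _; last first.
  by rewrite addSn addSn /= => h; have := leq_trans h (leq_addl s _); rewrite ltnn.
move=> _; have /size_poly1P[c c0 gc] : size g == 1 by rewrite eg.
exists (c^-1%:P *: C); rewrite -scalemxAl mxtraceZ eC gc -polyCM mulVf //.
Qed.

(** The polynomial is mu = tr (M C R), where tr (C R) = 1; the computation takes
    place modulo q = det (X - A), with the multiples of q carried along so that
    they can be cancelled at the end. *)
Lemma comm_mx_horner_mx (F : fieldType) n (A M : 'M[F]_n.+1) :
  size (mxminpoly A) = n.+2 -> M *m A = A *m M -> exists p, M = horner_mx A p.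
Proof.
move=> /adj_bezout[C trC] MA.
set Y := char_poly_mx A; set R := \adj Y in trC; set M' := map_mx polyC M.
have q0 : \det Y != 0 by rewrite monic_neq0 ?char_poly_monic.
have MY : M' *m Y = Y *m M'.
  rewrite /Y /char_poly_mx mulmxBr mulmxBl -!map_mxM MA.
  by rewrite scalar_mxC.
have MR : M' *m R = R *m M'.
  apply: (scalemx_inj q0); rewrite /= -[LHS]mul_scalar_mx -[RHS]mul_mx_scalar.
  rewrite -{1}mul_adj_mx -(mul_mx_adj Y) -!mulmxA; congr (_ *m _).
  by rewrite !mulmxA MY.
have [Z eZ] := adj_mul_adj Y C; have [Z' eZ'] := adj_mul_adj Y (M' *m C).
rewrite -/R trC scale1r in eZ; set mu := \tr _ in eZ'.
exists mu; apply: (@horner_mx_eq_of_factor _ _ _ _ _ (Z' - M' *m Z)).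
have e : (M' - mu%:M) *m R = \det Y *: (Z' - M' *m Z).
  have eM : M' *m R + \det Y *: (M' *m Z) = mu *: R + \det Y *: Z'.
    by rewrite -eZ' scalemxAr -mulmxDr -eZ !mulmxA MR.
  rewrite mulmxBl mul_scalar_mx scalerBr (canRL (addrK _) eM).
  by rewrite -(addrA (mu *: R)) (addrC (mu *: R)) addrK.
apply: (scalemx_inj q0); rewrite /= scalemxAl -e -mulmxA mul_adj_mx.
by rewrite mul_mx_scalar.
Qed.

(** * Duality and the nSSP *)

Lemma mxtrace_nondegenerate (R : comPzRingType) m n (M : 'M[R]_(m, n)) :
  (forall L, \tr (M *m L) = 0) -> M = 0.
Proof.
move=> trM; apply/matrixP=> i j; rewrite mxE -(trM (delta_mx j i)).
by rewrite mxtrace_mulC mxtrace_delta_mul.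
Qed.

(** A proper subspace of matrices is orthogonal to some M != 0 for the trace
    pairing; here the subspace is the range of f. *)
Lemma linear_surjectiveP (F : fieldType) m n p q (f : 'M[F]_(m, n) -> 'M[F]_(p, q)) :
  linear f -> (forall M, (forall L, \tr (M *m f L) = 0) -> M = 0) ->
  forall X, exists L, f L = X.
Proof.
move=> f_lin f_dual X.
pose f_linear := GRing.isLinear.Build F _ _ _ f f_lin.
pose g : {linear 'M[F]_(m, n) -> 'M[F]_(p, q)} := HB.pack f f_linear.
pose G := lin_mx g; suff /row_fullP[H HG] : row_full G.
  exists (vec_mx (mxvec X *m H)); apply: (can_inj mxvecK).
  rewrite -[f _]/(g _).
  by rewrite -mul_rV_lin -mulmxA HG mulmx1.
rewrite /row_full -mxrank_tr; apply: inj_row_free => v vG.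
have eM : (vec_mx v)^T = 0 :> 'M[F]_(q, p).
  apply: f_dual => L; have := congr1 (fun u => (u *m (mxvec L)^T) 0 0) vG.
  rewrite mul0mx -mulmxA -trmx_mul mul_vec_lin => e.
  (* The dot product of two flattened matrices is a trace. *)
  transitivity ((v *m (mxvec (f L))^T) 0 0); last by rewrite e mxE.
  rewrite -{2}(vec_mxK v) [RHS]mxE (reindex _ (curry_mxvec_bij _ _)) /=.
  rewrite [RHS](eq_bigr (fun ij => vec_mx v ij.1 ij.2 * f L ij.1 ij.2)); last first.
    by case=> i j _; rewrite /= [_^T _ _]mxE !mxvecE.
  rewrite -(pair_bigA _ (fun i j => vec_mx v i j * f L i j)) exchange_big /=.
  by apply: eq_bigr => i _; rewrite mxE; apply: eq_bigr => j _; rewrite mxE.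
by apply: (can_inj vec_mxK); rewrite -[LHS]trmxK eM trmx0 linear0.
Qed.

(** Adding a large multiple of a to x imposes the sign of a. *)
Lemma has_sign_perturb (R : realType) s (a x t : R) :
  has_sign s a -> (a = 0 -> x = 0) -> (a != 0 -> `|x| < t * `|a|) ->
  has_sign s (x + t * a).
Proof.
case: s => /= [a_gt0 _|a_lt0 _|->] hx.
- have := hx (lt0r_neq0 a_gt0); rewrite (gtr0_norm a_gt0) ltr_norml.
  by rewrite -ltrBlDr sub0r => /andP[].
- have := hx (ltr0_neq0 a_lt0); rewrite (ltr0_norm a_lt0) ltr_norml mulrN.
  by rewrite -[_ < 0]ltrBrDr sub0r => /andP[].
- by rewrite hx // mulr0 addr0.
Qed.

(** If the zero entries of A are zero in X, then X + t A lies in the same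
    qualitative class as A once t is large, and X = (X + t A) - t A.
    Conversely, having a zero entry at a given position is a linear condition. *)
Lemma T1P (R : realType) n (P : sign_pattern n) (A X : 'M[R]_n) :
  qual_class R P A -> T1 R P X <-> forall i j, A i j = 0 -> X i j = 0.
Proof.
move=> hA; split=> [[k [c [u [hu ->]]]] i j Aij0|hX].
  rewrite summxE big1 // => l _; rewrite mxE.
  have := hu l i j; have := hA i j; rewrite Aij0.
  by case: (P i j) => /= [| |_ ->]; rewrite ?ltxx ?mulr0.
(* t exceeds every ratio of entries; terms with A i j = 0 contribute 0. *)
pose t := 1 + \sum_i \sum_j `|X i j| / `|A i j|.
have ht i j : A i j != 0 -> `|X i j| < t * `|A i j|.
  move=> Aij; rewrite -ltr_pdivrMr ?normr_gt0 // /t (bigD1 i) //= (bigD1 j) //=.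
  have ge0 k l : 0 <= `|X k l| / `|A k l| by rewrite divr_ge0.
  have: 0 <= \sum_(l | l != j) `|X i l| / `|A i l| by exact: sumr_ge0.
  have: 0 <= \sum_(k | k != i) \sum_l `|X k l| / `|A k l|.
    by apply: sumr_ge0 => k _; exact: sumr_ge0.
  by lra.
exists 2%N, (fun k => if k == 0 then 1 else - t),
  (fun k => if k == 0 then X + t *: A else A); split.
  move=> k; case: ifP => _ // i j; rewrite !mxE.
  by apply: has_sign_perturb; [exact: hA | exact: hX | exact: ht].
by rewrite big_ord_recl big_ord1 /= scale1r scaleNr addrK.
Qed.

(** T1 + T2 is everything if and only if its orthogonal complement for the trace
    pairing is trivial.  The condition at M j i is orthogonality to T1, spanned
    by the elementary matrices at the nonzero positions of A; commuting with A
    is orthogonality to T2, since tr (M (A L - L A)) = tr ((M A - A M) L). *)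
Lemma nSSP_dual (R : realType) n (P : sign_pattern n) (A : 'M[R]_n) :
  qual_class R P A ->
  nSSP P A <-> forall M, M *m A = A *m M ->
    (forall i j, A i j != 0 -> M j i = 0) -> M = 0.
Proof.
move=> hA; split=> [spanA M MA M0|dualA].
  apply: mxtrace_nondegenerate => Y.
  have : (setT : set 'M[R]_n) Y by [].
  rewrite -spanA => -[X /(T1P _ hA) hX [_ [L _ <-] <-]].
  rewrite !mulmxDr !mxtraceD mulmxN linearN /= !mulmxA MA.
  rewrite (mxtrace_mulC (M *m L)) mulmxA addNr addr0.
  rewrite /mxtrace big1 // => i _; rewrite mxE big1 // => k _.
  have [/hX->|/M0->] := eqVneq (A k i) 0; by rewrite ?mulr0 ?mul0r.
pose mask (X : 'M[R]_n) := \matrix_(i, j) if A i j == 0 then 0 else X i j.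
(* T1 + T2 as the range of one linear map: the left half of U gives the summand
   in T1, the right half the matrix L of the summand in T2. *)
pose f (U : 'M[R]_(n, n + n)) :=
  mask (lsubmx U) + (- (rsubmx U *m A) + A *m rsubmx U).
have f_lin : linear f.
  move=> a U V; rewrite /f [lsubmx _]linearP [rsubmx _]linearP /= mulmxDl mulmxDr -scalemxAl -scalemxAr.
  rewrite !scalerDr opprD -scalerN [in RHS]addrACA [X in _ = _ + X]addrACA.
  congr (_ + _); apply/matrixP=> i j; rewrite !mxE.
  by case: ifP => _; rewrite ?mulr0 ?addr0.
have f_dual M : (forall U, \tr (M *m f U) = 0) -> M = 0.
  move=> Mf; apply: dualA => [|i j Aij].
    apply/eqP; rewrite -subr_eq0; apply/eqP/mxtrace_nondegenerate => L.
    have := Mf (row_mx 0 L); rewrite /f row_mxKl row_mxKr.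
    have -> : mask 0 = 0 by apply/matrixP=> i j; rewrite !mxE if_same.
    rewrite add0r mulmxDr mulmxN !mulmxA mulmxBl !linearD !linearN /= addrC.
    by rewrite (mxtrace_mulC (M *m L)) mulmxA.
  have := Mf (row_mx (delta_mx i j) 0); rewrite /f row_mxKl row_mxKr.
  have -> : mask (delta_mx i j) = delta_mx i j.
    apply/matrixP=> k l; rewrite !mxE; case: ifP => // /eqP Akl.
    case: andP => // -[/eqP ek /eqP el].
    by rewrite -ek -el Akl eqxx in Aij.
  by rewrite mul0mx mulmx0 oppr0 !addr0 mxtrace_mulC mxtrace_delta_mul.
apply/seteqP; split=> // Y _; have [U <-] := linear_surjectiveP f_lin f_dual Y.
exists (mask (lsubmx U)); last first.
  by exists (- (rsubmx U *m A) + A *m rsubmx U) => //; exists (rsubmx U).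
by apply/(T1P _ hA) => i j Aij; rewrite mxE Aij eqxx.
Qed.

(** * The Jacobian matrix *)

(** The function to be differentiated is affine in t.  The signs of s_(i+1) and of
    -A inside the characteristic matrix combine to (-1)^i. *)
Lemma pattern_jacobianE (R : realType) n (A : 'M[R]_n.+1) r
    (e : r.-tuple ('I_n.+1 * 'I_n.+1)) i j :
  pattern_jacobian A e i j = (-1) ^+ i *
  horner_mx A (drop_poly (n - i).+1 (char_poly A)) (tnth e j).2 (tnth e j).1.
Proof.
have sE (M : 'M[R]_n.+1) : sum_principal_minors i.+1 M = (-1) ^+ i.+1 * (char_poly M)`_(n - i).
  have := coef_char_poly_minors M (ltn_ord i).
  by rewrite subSS => ->; rewrite signrMK.
rewrite mxE -coef_adj_char_poly_mx.
set a := (\adj (char_poly_mx A) _ _)`_(n - i).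
pose s0 := sum_principal_minors i.+1 A.
have -> : (fun t : R => sum_principal_minors i.+1
    (A + t *: delta_mx (tnth e j).1 (tnth e j).2)) =
    (fun t => s0 + t * ((-1) ^+ i * a)).
  apply/funext => t; rewrite /s0 !sE char_poly_add_delta coefB coefZ -/a.
  by rewrite exprS; ring.
rewrite derive1E; apply: derive_val.
set c := _ * a.
have -> : (fun t : R => s0 + t * c) = cst s0 + c *: id.
  by apply/funext => t; rewrite !fctE mulrC.
by apply: is_derive_eq; rewrite add0r [LHS]mulr1.
Qed.

(** A row vector c is sent by the Jacobian to the entries of p(A) at the
    transposed nonzero positions of A, where p = \sum_i c_i b_i and b_i is, up to
    sign, the quotient of q by X^(n-i+1).  As b_i has degree i, the map
    c |-> p is a bijection onto the polynomials of degree at most n: the matrix T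
    of this map is triangular with diagonal entries 1 or -1. *)
Lemma row_free_jacobian (R : realType) n (A : 'M[R]_n.+1) r
    (e : r.-tuple ('I_n.+1 * 'I_n.+1)) :
  enumerates_nonzero A e ->
  row_free (pattern_jacobian A e) <->
  forall p : {poly R}, (size p <= n.+1)%N ->
    (forall i j, A i j != 0 -> horner_mx A p j i = 0) -> p = 0.
Proof.
move=> [_ mem_e]; set q := char_poly A; set J := pattern_jacobian A e.
have sq : size q = n.+2 by rewrite size_char_poly.
pose b (i : 'I_n.+1) := (-1) ^+ i *: drop_poly (n - i).+1 q.
have sb i : (size (b i) <= n.+1)%N.
  apply: leq_trans (size_scale_leq _ _) _.
  by rewrite size_drop_poly sq subSS leq_subLR addnS ltnS leq_addl.
pose T : 'M[R]_n.+1 := \matrix_i poly_rV (b i).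
have uT : T \in unitmx.
  have T_trig : is_trig_mx T.
    apply/is_trig_mxP => i j ltij.
    rewrite !mxE coefZ coef_drop_poly nth_default ?mulr0 // sq.
    by rewrite addnS ltnS; have := ltn_ord i; lia.
  rewrite unitmxE det_trig // unitfE; apply/prodf_neq0 => i _.
  rewrite !mxE coefZ coef_drop_poly mulf_neq0 ?signr_eq0 //.
  (* The diagonal entry of T is the leading coefficient of q, up to sign. *)
  have -> : (i + (n - i).+1 = (size q).-1)%N by rewrite sq; have := ltn_ord i; lia.
  by rewrite -lead_coefE lead_coef_eq0 monic_neq0 ?char_poly_monic.
have rVT c : rVpoly (c *m T) = \sum_i c 0 i *: b i.
  rewrite mulmx_sum_row linear_sum; apply: eq_bigr => i _.
  by rewrite linearZ rowK /= poly_rV_K.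
have cJ c j : (c *m J) 0 j =
    horner_mx A (rVpoly (c *m T)) (tnth e j).2 (tnth e j).1.
  rewrite mxE rVT linear_sum summxE; apply: eq_bigr => i _.
  by rewrite /J pattern_jacobianE !linearZ /= !mxE.
split=> [freeJ p sp p0|dual].
  pose c := poly_rV p *m invmx T.
  have cT : c *m T = poly_rV p by rewrite mulmxKV.
  suff c0 : c = 0 by rewrite -(poly_rV_K sp) -cT c0 mul0mx linear0.
  apply: (row_free_inj freeJ); rewrite mul0mx; apply/rowP=> j.
  by rewrite cJ cT poly_rV_K // mxE p0 // -mem_e mem_tnth.
apply: inj_row_free => c cJ0.
suff cT : c *m T = 0 by rewrite -(mulmxK uT c) cT mul0mx.
rewrite -[LHS]rVpolyK (dual (rVpoly (c *m T))) ?linear0 ?size_poly // => i j Aij.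
have /tnthP[k ek] : (i, j) \in e by rewrite mem_e.
by have := cJ c k; rewrite cJ0 mxE -ek.
Qed.

(** * The equivalence *)

Theorem theorem5p1 (R : realType) (n : nat) (P : sign_pattern n.+1)
  (A : 'M[R]_n.+1) (r : nat) (e : r.-tuple ('I_n.+1 * 'I_n.+1))
  (hA : qual_class R P A) (he : enumerates_nonzero A e) :
  row_free (pattern_jacobian A e) <->
  ((size (mxminpoly A)).-1 = n.+1 /\ nSSP P A).
Proof.
rewrite (nSSP_dual hA) (row_free_jacobian he).
set q := char_poly A; have sq : size q = n.+2 by rewrite size_char_poly.
have q0 : q != 0 by rewrite monic_neq0 ?char_poly_monic.
have m0 : mxminpoly A != 0 by rewrite monic_neq0 ?mxminpoly_monic.
have lemq : (size (mxminpoly A) <= n.+2)%N.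
  by rewrite -sq dvdp_leq ?mxminpoly_dvd_char.
split=> [dual|[sm dual] p sp p0].
  have sm : size (mxminpoly A) = n.+2.
    apply/eqP; rewrite eqn_leq lemq ltnNge; apply/negP => ltm.
    case/eqP: m0; apply: dual => // i j _.
    by rewrite mx_root_minpoly mxE.
  split=> [|M MA M0]; first by rewrite sm.
  have [p eM] := comm_mx_horner_mx sm MA.
  have {}eM : M = horner_mx A (p %% q).
    rewrite eM {1}(divp_eq p q) rmorphD rmorphM /= Cayley_Hamilton.
    by rewrite mulr0 add0r.
  rewrite eM (dual (p %% q)) ?rmorph0 -?eM //.
  by rewrite -ltnS -sq ltn_modp.
have Ap : horner_mx A p = 0 by apply: dual => //; exact: comm_horner_mx.
apply/eqP/negPn/negP => pn0.
have := dvdp_leq pn0 (mxminpoly_min Ap).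
move: sm; rewrite size_mxminpoly /= => ->.
by move=> /leq_trans/(_ sp); rewrite ltnn.
Qed.
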